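(* Let $M$ and $N$ be weight sequences. Consider the following assertions: (i) $\sup_{j\in\mathbb{N}_{>0}}(N_j/M_j)^{1/j}<+\infty$; (ii) $v_M\preceq_{\mathfrak c}v_N$; (iii) $H^{\infty}_{\underline{\mathcal M}_{\mathfrak c}}\subseteq H^{\infty}_{\underline{\mathcal N}_{\mathfrak c}}$ and $H^{\infty}_{\overline{\mathcal M}_{\mathfrak c}}\subseteq H^{\infty}_{\overline{\mathcal N}_{\mathfrak c}}$, with continuous inclusions. Then (i)$\Rightarrow$(ii)$\Rightarrow$(iii) is valid.
   Context: $\mathbb{N}=\{0,1,2,\dots\}$, $\mathbb{N}_{>0}=\{1,2,\dots\}$. A weight is a continuous, non-increasing function $v:[0,+\infty)\to(0,+\infty)$ with $\lim_{t\to+\infty}t^kv(t)=0$ for all $k\ge0$. $H(\mathbb{C})$ is the space of entire functions and $H^{\infty}_v:=\{f\in H(\mathbb{C}):\|f\|_v:=\sup_{z\in\mathbb{C}}|f(z)|v(|z|)<+\infty\}$, a Banach space with norm $\|\cdot\|_v$. A weight sequence is $M=(M_j)_{j\in\mathbb{N}}$ with $M_j>0$, $M_0=1$ and $\lim_{j\to+\infty}(M_j)^{1/j}=+\infty$. Put $\omega_M(t):=\sup_{j\in\mathbb{N}}\log(t^j/M_j)$ for $t>0$, $\omega_M(0):=0$. For $c>0$ let $v_{M,c}(t):=\exp(-\omega_M(ct))$ and $v_M:=v_{M,1}$; these are weights. Put $\underline{\mathcal M}_{\mathfrak c}:=(v_{M,c})_{c\in\mathbb{N}_{>0}}$ and $\overline{\mathcal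 M}_{\mathfrak c}:=(v_{M,1/c})_{c\in\mathbb{N}_{>0}}$. $H^{\infty}_{\underline{\mathcal M}_{\mathfrak c}}:=\varinjlim_{c\to\infty}H^{\infty}_{v_{M,c}}$ is the locally convex inductive limit (an (LB)-space; as a set the union), and $H^{\infty}_{\overline{\mathcal M}_{\mathfrak c}}:=\varprojlim_{c\to\infty}H^{\infty}_{v_{M,1/c}}$ is the projective limit (a Fréchet space; as a set the intersection). Same notation with $N$, $\mathcal N$. For weights $v,w$: $v\preceq_{\mathfrak c}w$ means there are $c\ge1$ and $C\ge1$ with $w(ct)\le Cv(t)$ for all $t\ge0$. *)

(* Defs.v *)
From HB Require Import structures.
From mathcomp Require Import all_boot all_order all_algebra.
From mathcomp Require Import complex.
From mathcomp Require Import ring.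
From mathcomp Require Import all_classical all_reals all_analysis.

Set Implicit Arguments.
Unset Strict Implicit.
Unset Printing Implicit Defensive.

Import Order.TTheory GRing.Theory Num.Theory.
Import numFieldNormedType.Exports numFieldTopology.Exports.
Import Normc.

Local Open Scope classical_set_scope.
Local Open Scope ring_scope.
Local Open Scope complex_scope.

(* Only the values on [0, +oo[ are meaningful. *)
Record weight (R : realType) := Weight {
  weight_fun :> R -> R ;
  weight_gt0 : forall t, 0 <= t -> 0 < weight_fun t ;
  weight_continuous : {within `[0, +oo[, continuous weight_fun} ;
  weight_nonincreasing :
    forall s t, 0 <= s -> s <= t -> weight_fun t <= weight_fun s ;
  weight_rapid_decay :
    forall k : nat, t ^+ k * weight_fun t @[t --> +oo] --> 0 }.

Definition preceq_c (R : realType) (v w : weight R) : Prop :=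
  exists c C : R, [/\ 1 <= c, 1 <= C &
    forall t, 0 <= t -> w (c * t) <= C * v t].

Record weight_sequence (R : realType) := WeightSequence {
  wseq :> nat -> R ;
  wseq_gt0 : forall j, 0 < wseq j ;
  wseq0 : wseq 0%N = 1 ;
  wseq_root_cvgy : wseq j `^ j%:R^-1 @[j --> \oo] --> +oo }.

Section associated_weight.
Context {R : realType} (M : weight_sequence R).

Definition omega (t : R) : R :=
  if 0 < t then sup [set ln (t ^+ j / M j) | j in [set: nat]] else 0.

Definition omega_trunc (J : nat) (t : R) : R :=
  \big[Order.max/1]_(j < J) (t ^+ j / M j).

Lemma wseq_ge_exp (T : R) : 0 < T ->
  exists J, forall j, (J < j)%N -> T ^+ j <= M j.
Proof.
move=> T0; have /cvgryPge/(_ T)[J _ JT] := wseq_root_cvgy M.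
exists J => j Jj; have j0 : j%:R != 0 :> R.
  by rewrite pnatr_eq0 -lt0n (leq_ltn_trans _ Jj).
have -> : M j = (M j `^ j%:R^-1) ^+ j.
  by rewrite -powR_mulrn ?powR_ge0// -powRrM mulVf// powRr1// ltW// wseq_gt0.
rewrite lerXn2r ?nnegrE ?powR_ge0 ?(ltW T0)//; exact/JT/ltnW.
Qed.

Lemma omega_trunc_ge1 J t : 1 <= omega_trunc J t.
Proof. exact: bigmax_ge_id. Qed.

Lemma omega_trunc_continuous J : continuous (omega_trunc J).
Proof.
rewrite /omega_trunc; elim: (index_enum _) => [|j r IH] t.
  under eq_fun do rewrite big_nil.
  exact: cvg_cst.
under eq_fun do rewrite big_cons.
apply: (cvg_comp2 _ (IH t) (@max_continuous _ R (_, _))).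
apply: cvgMl; exact: exprn_continuous.
Qed.

Lemma omega_trunc_le J s t : 0 <= s -> s <= t ->
  omega_trunc J s <= omega_trunc J t.
Proof.
move=> s0 st; apply: le_bigmax2 => j _.
rewrite ler_pM2r ?invr_gt0 ?wseq_gt0// lerXn2r ?nnegrE//.
exact: le_trans st.
Qed.

Lemma omega_trunc_ge (T : R) : 0 < T ->
  exists J, forall t j, 0 <= t <= T -> t ^+ j / M j <= omega_trunc J t.
Proof.
move=> T0; have [J MJ] := wseq_ge_exp T0; exists J.+1 => t j /andP[t0 tT].
have [jJ|jJ] := ltnP J j; last first.
  exact: (le_bigmax _ _ (Ordinal (jJ : (j < J.+1)%N))).
rewrite (le_trans _ (omega_trunc_ge1 _ _))// ler_pdivrMr ?wseq_gt0// mul1r.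
by rewrite (le_trans _ (MJ _ jJ))// lerXn2r ?nnegrE// ltW.
Qed.

Lemma le_expR_omega t j : 0 <= t -> t ^+ j / M j <= expR (omega t).
Proof.
rewrite le_eqVlt => /predU1P[<-|t0].
  rewrite /omega ltxx expR0; case: j => [|j]; last by rewrite expr0n/= mul0r.
  by rewrite expr0 wseq0 divr1.
have [J HJ] := omega_trunc_ge t0.
have tM_gt0 i : 0 < t ^+ i / M i by rewrite divr_gt0 ?exprn_gt0 ?wseq_gt0.
rewrite /omega t0 -[leLHS]lnK ?posrE// ler_expR.
apply: ub_le_sup; last by exists j.
exists (ln (omega_trunc J t)) => _ [i _ <-].
rewrite ler_ln ?posrE//; last exact: lt_le_trans (omega_trunc_ge1 _ _).
by rewrite HJ ?lexx ?ltW.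
Qed.

Lemma expR_omega (T : R) : 0 < T ->
  exists J, forall t, 0 <= t <= T -> expR (omega t) = omega_trunc J t.
Proof.
move=> T0; have [J HJ] := omega_trunc_ge T0; exists J => t tT.
have t0 : 0 <= t by case/andP: tT.
apply/eqP; rewrite eq_le; apply/andP; split; last first.
  apply/bigmax_leP; split => [|j _]; last exact: le_expR_omega.
  by have := le_expR_omega 0 t0; rewrite expr0 wseq0 divr1.
rewrite /omega; case: ifPn => [{}t0|_]; last by rewrite expR0 omega_trunc_ge1.
have tr_gt0 : 0 < omega_trunc J t by exact: lt_le_trans (omega_trunc_ge1 _ _).
rewrite -[leRHS]lnK ?posrE// ler_expR; apply: ge_sup.
  by exists (ln (t ^+ 0 / M 0%N)); exists 0%N.
by move=> _ [j _ <-]; rewrite ler_ln ?posrE ?HJ// divr_gt0 ?exprn_gt0 ?wseq_gt0.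
Qed.

Section rescaled.
Variable c : {posnum R}.
Let v (t : R) : R := expR (- omega (c%:num * t)).

Let v_gt0 t : 0 <= t -> 0 < v t.
Proof. by move=> _; exact: expR_gt0. Qed.

Let vP (T : R) : exists J, forall t, 0 <= t <= T ->
  v t = (omega_trunc J (c%:num * t))^-1.
Proof.
have [J HJ] := @expR_omega (c%:num * Num.max T 1) ltac:(by rewrite mulr_gt0// lt_max ltr01 orbT).
exists J => t /andP[t0 tT]; rewrite /v expRN HJ// mulr_ge0//= ler_pM2l//.
by rewrite le_max tT.
Qed.

Let v_continuous : {within `[0, +oo[, continuous v}.
Proof.
apply/subspace_continuousP => x; rewrite /= in_itv/= andbT => x0.
have [J HJ] := vP (x + 1).
rewrite /from_subspace HJ ?x0 ?lerDl ?ler01//.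
apply: (@cvg_trans _ ((fun t => (omega_trunc J (c%:num * t))^-1) @
    within `[0, +oo[ (nbhs x))); last first.
  apply: cvg_within_filter.
  apply: cvgV.
    by rewrite gt_eqF// (lt_le_trans _ (omega_trunc_ge1 _ _)).
  apply: (continuous_comp _ (@omega_trunc_continuous J _)).
  exact: mulrl_continuous.
apply: near_eq_cvg; rewrite near_withinE.
near=> t; rewrite /= in_itv/= andbT => t0; rewrite HJ// t0/=.
by apply/ltW; near: t; apply: lt_nbhsl; rewrite ltrDl.
Unshelve. all: by end_near. Qed.

Let v_nonincreasing s t : 0 <= s -> s <= t -> v t <= v s.
Proof.
move=> s0 st; have [J HJ] := vP t.
rewrite !HJ ?s0 ?st ?lexx ?(le_trans s0)// lef_pV2 ?posrE; last 2 first.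
- by rewrite (lt_le_trans _ (omega_trunc_ge1 _ _)).
- by rewrite (lt_le_trans _ (omega_trunc_ge1 _ _)).
by rewrite omega_trunc_le ?mulr_ge0// ler_pM2l.
Qed.

Let v_rapid_decay k : t ^+ k * v t @[t --> +oo] --> 0.
Proof.
pose K := M k.+1 / c%:num ^+ k.+1.
apply: (@squeeze_cvgr _ _ _ _ (cst 0) (fun t => K * t^-1)).
- near=> t; have t0 : 0 < t by near: t; exact: nbhs_pinfty_gt.
  rewrite mulr_ge0 ?exprn_ge0 ?(ltW t0) ?expR_ge0//= /v expRN.
  have ct0 : 0 < c%:num * t by rewrite mulr_gt0.
  rewrite ler_pdivrMr ?expR_gt0//.
  apply: le_trans (ler_wpM2l _ (le_expR_omega k.+1 (ltW ct0))); last first.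
    by rewrite mulr_ge0 ?invr_ge0 ?(ltW t0)// divr_ge0 ?exprn_ge0// ltW ?wseq_gt0.
  rewrite le_eqVlt; apply/orP; left; apply/eqP; rewrite /K exprMn !exprS.
  have Mk := wseq_gt0 M k.+1.
  field.
  by rewrite !gt_eqF.
- exact: cvg_cst.
rewrite -(mulr0 K); apply: cvgMr; apply/gtr0_cvgV0; last exact: cvg_id.
exact: nbhs_pinfty_gt.
Unshelve. all: by end_near. Qed.

Definition assoc_weight : weight R :=
  Weight v_gt0 v_continuous v_nonincreasing v_rapid_decay.

End rescaled.

End associated_weight.

Section Hinf.
Context {R : realType}.
Local Notation C := R[i].
Implicit Types v : weight R.

Definition entire (f : C -> C) : Prop :=
  forall z : C, derivable (f : C^o -> C^o) z 1.

(* [normc] is the modulus with values in [R]; [`|z|] lives in [C]. *)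
Definition Hinf_set v : set (C -> C) :=
  [set f | entire f /\
    has_ubound (range (fun z : C => normc (f z) * v (normc z)))].

Definition Hinf_norm v (f : C -> C) : R :=
  sup (range (fun z : C => normc (f z) * v (normc z))).

Definition Hinf v : Type := set_type (Hinf_set v).

HB.instance Definition _ v := SubType.on (Hinf v).
HB.instance Definition _ v := Choice.on (Hinf v).

Let normc_ge0 (z : C) : 0 <= normc z.
Proof. by case: z => x y; exact: sqrtr_ge0. Qed.

Let v_ge0 v (z : C) : 0 <= v (normc z).
Proof. by apply/ltW/weight_gt0. Qed.

Lemma Hinf_norm_le v (f : C -> C) B :
  (forall z, normc (f z) * v (normc z) <= B) -> Hinf_norm v f <= B.
Proof.
move=> fB; apply: ge_sup; first by exists (normc (f 0) * v (normc 0)), 0.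
by move=> _ [z _ <-].
Qed.

Lemma Hinf_norm_ge v (f : C -> C) z :
  Hinf_set v f -> normc (f z) * v (normc z) <= Hinf_norm v f.
Proof. by case=> _ fB; apply: ub_le_sup => //; exists z. Qed.

Lemma Hinf_closed v : submod_closed (mem (Hinf_set v)).
Proof.
split; first (apply/mem_set; split).
- by move=> z; exact: derivable_cst.
- by exists 0 => _ [z _ <-]; rewrite normc0 mul0r.
move=> a f g /set_mem[ef [B fB]] /set_mem[eg [D gD]]; apply/mem_set; split.
  by move=> z; apply: derivableD => //; exact: derivableZ.
exists (normc a * B + D) => _ [z _ <-].
apply: (@le_trans _ _ ((normc a * normc (f z) + normc (g z)) * v (normc z))).
  by rewrite ler_wpM2r// -normcM; exact: le_normcD.
rewrite mulrDl -mulrA lerD//; last by apply: gD; exists z.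
by rewrite ler_wpM2l//; apply: fB; exists z.
Qed.

HB.instance Definition _ v := GRing.SubChoice_isSubLmodule.Build C (C -> C)
  (mem (Hinf_set v)) (Hinf v) (Hinf_closed v).

Let norm v (f : Hinf v) : C := (Hinf_norm v (val f))%:C.

Let ler_normD v (f g : Hinf v) : norm (f + g) <= norm f + norm g.
Proof.
rewrite /norm -rmorphD lecR; apply: Hinf_norm_le => z.
apply: (@le_trans _ _ ((normc (val f z) + normc (val g z)) * v (normc z))).
  by rewrite ler_wpM2r//; exact: le_normcD.
by rewrite mulrDl lerD// Hinf_norm_ge//; apply/set_mem/valP.
Qed.

Let ler_normZ v (l : C) (f : Hinf v) : norm (l *: f) <= `|l| * norm f.
Proof.
rewrite /norm -[`|l|]/((normc l)%:C) -rmorphM lecR; apply: Hinf_norm_le => z.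
rewrite -[normc _]/(normc (l * val f z)) normcM -mulrA ler_wpM2l//.
by rewrite Hinf_norm_ge//; apply/set_mem/valP.
Qed.

Let normrZ v (l : C) (f : Hinf v) : norm (l *: f) = `|l| * norm f.
Proof.
apply/eqP; rewrite eq_le ler_normZ/=.
have [->|l0] := eqVneq l 0.
  rewrite normr0 mul0r /norm -(rmorph0 (real_complex R)) lecR.
  apply: le_trans (Hinf_norm_ge 0 _); last exact/set_mem/valP.
  by rewrite mulr_ge0.
rewrite -[f in leLHS](scalerK l0) -ler_pdivlMl ?normr_gt0//.
by rewrite -normfV; exact: ler_normZ.
Qed.

Let normr0_eq0 v (f : Hinf v) : norm f = 0 -> f = 0.
Proof.
rewrite /norm -(rmorph0 (real_complex R)) => -[f0].
apply/val_inj/funext => z; apply: eq0_normc.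
have := Hinf_norm_ge z (set_mem (valP f)); rewrite f0 pmulr_lle0 ?weight_gt0//.
by move=> le0; apply/eqP; rewrite eq_le le0/=.
Qed.

HB.instance Definition _ v := Lmodule_isNormed.Build C (Hinf v)
  (@ler_normD v) (@normrZ v) (@normr0_eq0 v).

End Hinf.

Section limits.
Context {R : realType}.
Local Notation C := R[i].
Implicit Types V W : nat -> weight R.

Definition absolutely_convex (U : set (C -> C)) : Prop :=
  forall (a b : C) (f g : C -> C),
    `|a| + `|b| <= 1 -> U f -> U g -> U (a *: f + b *: g).

Definition indlim_set V : set (C -> C) := \bigcup_n Hinf_set (V n).

Definition indlim V : Type := set_type (indlim_set V).

HB.instance Definition _ V := SubType.on (indlim V).
HB.instance Definition _ V := Choice.on (indlim V).

(* When the steps increase, the traces on the union of these sets are the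
   absolutely convex 0-neighbourhoods of the finest locally convex topology
   making all inclusions of the steps continuous. *)
Definition indlim_nbhs0 V : set_system (C -> C) :=
  [set U | absolutely_convex U /\
    forall n, nbhs (0 : Hinf (V n)) [set f | U (val f)]].

Definition indlim_nbhs V (f : indlim V) : set_system (indlim V) :=
  [set A | exists2 U, indlim_nbhs0 V U & [set g | U (val g - val f)] `<=` A].

HB.instance Definition _ V := hasNbhs.Build (indlim V) (@indlim_nbhs V).

Let indlim_nbhs0_0 V U : indlim_nbhs0 V U -> U 0.
Proof. by case=> _ /(_ 0%N)/nbhs_singleton. Qed.

Let indlim_nbhs_singleton V (f : indlim V) (A : set (indlim V)) :
  nbhs f A -> A f.
Proof. by case=> U U0; apply; rewrite /= subrr; exact: indlim_nbhs0_0 U0. Qed.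

Let indlim_nbhs_filter V (f : indlim V) : ProperFilter (nbhs f).
Proof.
apply: Build_ProperFilter; first by move=> /indlim_nbhs_singleton.
split.
- by exists setT => //; split => // n; exact: filterT.
- move=> A B [U [cU nU] UA] [W [cW nW] WB]; exists (U `&` W).
    split=> [a b g h ab [Ug Wg] [Uh Wh]|n]; first by split; auto.
    exact: filterI.
  by move=> g [Ug Wg]; split; [exact: UA|exact: WB].
- by move=> A B AB [U nU UA]; exists U => // g /UA/AB.
Qed.

Let indlim_nbhs_nbhs V (f : indlim V) (A : set (indlim V)) :
  nbhs f A -> nbhs f (nbhs^~ A).
Proof.
move=> [U [cU nU] UA]; pose U2 : set (C -> C) := [set h | U (2 *: h)].
have nU2 : indlim_nbhs0 V U2.
  split=> [a b g h ab Ug Uh|n].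
    rewrite /U2 /= scalerDr !scalerA ![2 * _]mulrC -!scalerA; exact: cU.
  have := @scaler_continuous C (Hinf (V n)) 2 0.
  by rewrite /continuous_at scaler0 => /(_ _ (nU n)).
exists U2 => // g U2g; exists U2 => // h U2h; apply: UA => /=.
have -> : val h - val f =
    2^-1 *: (2 *: (val h - val g)) + 2^-1 *: (2 *: (val g - val f)).
  by rewrite !scalerA mulVf ?pnatr_eq0// !scale1r addrA subrK.
apply: cU => //; rewrite ger0_norm ?invr_ge0 ?ler0n//.
by rewrite -[2^-1]mul1r -splitr.
Qed.

HB.instance Definition _ V := Nbhs_isNbhsTopological.Build (indlim V)
  (@indlim_nbhs_filter V) (@indlim_nbhs_singleton V) (@indlim_nbhs_nbhs V).

Definition indlim_incl V W (VW : indlim_set V `<=` indlim_set W)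
    (f : indlim V) : indlim W :=
  exist _ (val f) (mem_set (VW _ (set_mem (valP f)))).

Definition projlim_set V : set (C -> C) := \bigcap_n Hinf_set (V n).

Definition projlim V : Type := set_type (projlim_set V).

HB.instance Definition _ V := SubType.on (projlim V).
HB.instance Definition _ V := Choice.on (projlim V).

Definition projlim_proj V n (f : projlim V) : Hinf (V n) :=
  exist _ (val f) (mem_set (set_mem (valP f) n I)).

HB.instance Definition _ V := Topological.copy (projlim V)
  (initial_topology (fun f : projlim V =>
    (fun n => projlim_proj n f) : prod_topology (fun n => Hinf (V n)))).

Definition projlim_incl V W (VW : projlim_set V `<=` projlim_set W)
    (f : projlim V) : projlim W :=
  exist _ (val f) (mem_set (VW _ (set_mem (valP f)))).

End limits.

Definition lower_system (R : realType) (M : weight_sequence R) (n : nat) :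
  weight R := assoc_weight M (n.+1%:R)%:pos.

Definition upper_system (R : realType) (M : weight_sequence R) (n : nat) :
  weight R := assoc_weight M (n.+1%:R^-1)%:pos.

(* Main.v *)
Require Import Defs.
From HB Require Import structures.
From mathcomp Require Import all_boot all_order all_algebra.
From mathcomp Require Import complex.
From mathcomp Require Import all_classical all_reals all_analysis.

Import Order.TTheory GRing.Theory Num.Theory.
Import numFieldNormedType.Exports numFieldTopology.Exports.

Local Open Scope classical_set_scope.
Local Open Scope ring_scope.

(** The growth condition (i) says that [N j <= A ^+ j * M j] for some [A >= 1],
    so every term [t ^+ j / M j] is at most [(A * t) ^+ j / N j]. Passing to the
    supremum over [j] gives [omega M t <= omega N (A * t)], which after
    exponentiating is the weight comparison (ii) with multiplicative constant 1
    ([preceq_c_of_root_bound]).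

    For (ii) implies (iii), the point is that a pointwise estimate
    [w <= D * v] between weights makes the step [Hinf v] sit inside [Hinf w]
    with an inclusion of norm at most [D] ([Hinf_incl_continuous]). Rescaling the
    argument in (ii) turns it into such estimates between the two systems: a
    dilation by [c] is absorbed by moving to a later index, the weights being
    non-increasing. For the inductive limits each step of the [M]-system is
    dominated by some step of the [N]-system; for the projective limits each step
    of the [N]-system is dominated by some step of the [M]-system. Both times
    continuity is inherited from the steps: an absolutely convex set is a
    0-neighbourhood in the inductive limit as soon as its traces on the steps
    are ([indlim_incl_continuous]), and a map into the projective limit is
    continuous as soon as its components are ([projlim_incl_continuous]). *)

(** * Steps: inclusions between weighted spaces *)

Lemma normc_ge0 {R : realType} (z : R[i]) : 0 <= Normc.normc z.
Proof. by case: z => x y; exact: sqrtr_ge0. Qed.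

Lemma Hinf_norm_bound {R : realType} {v w : weight R} (D : R)
    (f : R[i] -> R[i]) : 0 <= D -> (forall t, 0 <= t -> w t <= D * v t) ->
  Hinf_set v f -> forall z,
  Normc.normc (f z) * w (Normc.normc z) <= D * Hinf_norm v f.
Proof.
move=> D0 vw fv z.
apply: le_trans (ler_wpM2l D0 (Hinf_norm_ge z fv)).
by rewrite mulrCA ler_wpM2l ?normc_ge0// vw ?normc_ge0.
Qed.

Lemma weight_bound_ge0 {R : realType} {v w : weight R} (D : R) :
  (forall t, 0 <= t -> w t <= D * v t) -> 0 <= D.
Proof.
move=> /(_ 0 (lexx _)) wv.
rewrite -(pmulr_lge0 _ (weight_gt0 v (lexx 0))).
by apply: le_trans wv; exact/ltW/weight_gt0.
Qed.

Lemma Hinf_subset {R : realType} {v w : weight R} (D : R) :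
  (forall t, 0 <= t -> w t <= D * v t) -> Hinf_set v `<=` Hinf_set w.
Proof.
move=> vw f fv; split; first by case: fv.
exists (D * Hinf_norm v f) => _ [z _ <-].
exact: Hinf_norm_bound (weight_bound_ge0 _ vw) vw fv z.
Qed.

Definition Hinf_incl {R : realType} {v w : weight R}
    (vw : Hinf_set v `<=` Hinf_set w) (f : Hinf v) : Hinf w :=
  exist _ (val f) (mem_set (vw _ (set_mem (valP f)))).

(** The inclusion commutes with differences, so the bound [D] on its norm makes
    it Lipschitz. *)
Lemma Hinf_incl_continuous {R : realType} {v w : weight R} (D : R)
    (vw : Hinf_set v `<=` Hinf_set w) :
  (forall t, 0 <= t -> w t <= D * v t) -> continuous (Hinf_incl vw).
Proof.
move=> wv f; have D0 := weight_bound_ge0 _ wv.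
apply/(@cvgrPdist_lt _ _ _ (nbhs f)) => e e0.
(* [D] may be 0 as far as [D0] tells; [D + 1] is a bound one can divide by. *)
have D1 : 0 < (D + 1)%:C%C :> R[i] by rewrite ltcR ltr_wpDl.
have := @cvgr_dist_lt _ (Hinf v) _ _ (nbhs_filter (f : Hinf v))
  id f cvg_id _ (divr_gt0 e0 D1).
apply: (@filterS _ _ (nbhs_filter (f : Hinf v))) => g; rewrite ltr_pdivlMr//; apply: le_lt_trans.
have -> : `|Hinf_incl vw f - Hinf_incl vw g|
  = (Hinf_norm w (val (f - g)))%:C%C by [].
have -> : `|f - g| = (Hinf_norm v (val (f - g)))%:C%C by [].
rewrite -rmorphM lecR mulrC; apply: Hinf_norm_le => z.
apply: Hinf_norm_bound; [exact: addr_ge0| |exact/set_mem/valP].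
move=> t t0; apply: (le_trans (wv t t0)).
by rewrite ler_wpM2r ?lerDl//; exact/ltW/weight_gt0.
Qed.

(** * Limits of systems of weights *)

(** A neighbourhood [U] of 0 downstairs is itself one upstairs: its trace on a
    step [V n] is the preimage of its trace on a step [W m] that contains it. *)
Lemma indlim_incl_continuous {R : realType} {V W : nat -> weight R} :
  (forall n, exists m D, forall t, 0 <= t -> W m t <= D * V n t) ->
  exists VW : indlim_set V `<=` indlim_set W, continuous (indlim_incl VW).
Proof.
move=> dom.
have VW : indlim_set V `<=` indlim_set W.
  move=> f [n _ fn]; have [m [D wv]] := dom n.
  by exists m => //; exact: Hinf_subset wv _ fn.
exists VW => f A [U [cU nU] UA]; exists U => [|g Ug]; last exact: UA.
split=> // n; have [m [D wv]] := dom n.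
have incl0 : Hinf_incl (Hinf_subset _ wv) 0 = 0 by exact: val_inj.
have := Hinf_incl_continuous _ (Hinf_subset _ wv) wv 0.
by rewrite /continuous_at incl0 => /(_ _ (nU m)).
Qed.

Lemma projlim_proj_continuous {R : realType} (V : nat -> weight R) n :
  continuous (@projlim_proj R V n).
Proof.
pose p (f : projlim V) : prod_topology (fun n => Hinf (V n)) :=
  fun n => projlim_proj n f.
move=> f; apply: (@continuous_comp (projlim V) _ _ p (@proj _ _ n)).
  exact: (@initial_continuous _ _ p).
exact: (@proj_continuous _ (fun n => Hinf (V n))).
Qed.

(** The [n]-th component of the inclusion factors through the projection onto a
    step [V m] contained in [W n]. *)
Lemma projlim_incl_continuous {R : realType} {V W : nat -> weight R} :
  (forall n, exists m D, forall t, 0 <= t -> W n t <= D * V m t) ->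
  exists VW : projlim_set V `<=` projlim_set W, continuous (projlim_incl VW).
Proof.
move=> dom.
have VW : projlim_set V `<=` projlim_set W.
  move=> f fV n _; have [m [D wv]] := dom n.
  exact: Hinf_subset wv _ (fV m I).
exists VW; apply: continuous_comp_initial.
pose p (f : projlim V) : forall n, Hinf (W n) :=
  fun n => projlim_proj n (projlim_incl VW f).
have p_cont n :
    continuous (p : projlim V -> initial_topology (@proj _ (Hinf \o W) n)).
  apply: continuous_comp_initial; have [m [D wv]] := dom n.
  have -> : @proj _ (Hinf \o W) n \o p =
      Hinf_incl (Hinf_subset _ wv) \o @projlim_proj R V m.
    by apply/funext => g; exact: val_inj.
  move=> f; apply: continuous_comp; first exact: projlim_proj_continuous.
  exact: Hinf_incl_continuous wv _.
(* The product topology is by definition the supremum of the topologies induced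
   by the projections. *)
move=> f; apply/(@cvg_sup _ _ _ _ _ (fmap_filter _ (nbhs_filter f))) => n.
exact: p_cont.
Qed.

(** * Comparison of associated weights *)

Lemma omega_le {R : realType} (M : weight_sequence R) (t y : R) :
  0 <= t -> (forall j, t ^+ j / M j <= expR y) -> omega M t <= y.
Proof.
move=> t0 tM; have [->|tn0] := eqVneq t 0.
  rewrite /omega ltxx -ler_expR expR0.
  by have := tM 0%N; rewrite wseq0 expr0 divr1.
have {}t0 : 0 < t by rewrite lt_neqAle eq_sym tn0.
rewrite /omega t0; apply: ge_sup; first by exists (ln (t ^+ 0 / M 0%N)), 0%N.
move=> _ [j _ <-]; rewrite -ler_expR lnK ?tM// posrE.
by rewrite divr_gt0 ?exprn_gt0 ?wseq_gt0.
Qed.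

Lemma wseq_le_of_root_bound {R : realType} (M N : weight_sequence R) :
  has_ubound [set (N j / M j) `^ j%:R^-1 | j in [set j | (0 < j)%N]] ->
  exists2 A : R, 1 <= A & forall j, N j <= A ^+ j * M j.
Proof.
move=> [B NMB]; exists (Num.max B 1); first by rewrite le_max lexx orbT.
move=> [|j]; first by rewrite !wseq0 expr0 mul1r.
have NM0 : 0 <= N j.+1 / M j.+1 by rewrite divr_ge0// ltW// wseq_gt0.
rewrite -ler_pdivrMr ?wseq_gt0//.
have -> : N j.+1 / M j.+1 = ((N j.+1 / M j.+1) `^ j.+1%:R^-1) ^+ j.+1.
  by rewrite -powR_mulrn ?powR_ge0// -powRrM mulVf ?pnatr_eq0// powRr1.
rewrite lerXn2r ?nnegrE ?powR_ge0// ?le_max ?ler01 ?orbT//.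
by apply/orP; left; apply: NMB; exists j.+1.
Qed.

Lemma preceq_c_of_root_bound {R : realType} (M N : weight_sequence R) :
  has_ubound [set (N j / M j) `^ j%:R^-1 | j in [set j | (0 < j)%N]] ->
  preceq_c (assoc_weight M 1%:pos) (assoc_weight N 1%:pos).
Proof.
move=> /wseq_le_of_root_bound[A A1 NM]; have A0 := le_trans ler01 A1.
exists A, 1; split=> // t t0 /=.
rewrite !mul1r ler_expR lerN2; apply: omega_le => // j.
apply: le_trans (le_expR_omega N j (mulr_ge0 A0 t0)).
rewrite ler_pdivrMr ?wseq_gt0// mulrAC ler_pdivlMr ?wseq_gt0//.
rewrite exprMn (mulrC (A ^+ j)) -mulrA.
by rewrite ler_wpM2l ?exprn_ge0.
Qed.

(** Substituting [a * t] for [t] in the comparison bounds the [N]-weight with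
    dilation [c * a]; a larger dilation [b] only makes that weight smaller. The
    factor [c] is rounded up to an integer because the dilations occurring in
    the two systems are integers and their inverses. *)
Lemma preceq_c_rescale {R : realType} (M N : weight_sequence R) :
  preceq_c (assoc_weight M 1%:pos) (assoc_weight N 1%:pos) ->
  exists (k : nat) (D : R), forall a b : {posnum R},
    k.+1%:R * a%:num <= b%:num -> forall t, 0 <= t ->
    assoc_weight N b t <= D * assoc_weight M a t.
Proof.
move=> [c [D [c1 D1 NM]]]; have c0 := le_trans ler01 c1.
exists (Num.truncn c), D => a b ab t t0.
have at0 : 0 <= a%:num * t by exact: mulr_ge0.
have := NM _ at0; rewrite /= !mul1r; apply: le_trans.
have := @weight_nonincreasing _ (assoc_weight N 1%:pos)
  (c * (a%:num * t)) (b%:num * t).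
rewrite /= !mul1r; apply; first exact: mulr_ge0.
rewrite mulrA ler_wpM2r//; apply: le_trans ab.
by rewrite ler_wpM2r// ltW// truncnS_gt.
Qed.

Theorem proposition3p9 (R : realType) (M N : weight_sequence R) :
  (has_ubound [set (N j / M j) `^ j%:R^-1 | j in [set j | (0 < j)%N]] ->
    preceq_c (assoc_weight M 1%:pos) (assoc_weight N 1%:pos)) /\
  (preceq_c (assoc_weight M 1%:pos) (assoc_weight N 1%:pos) ->
    (exists MN : indlim_set (lower_system M) `<=` indlim_set (lower_system N),
      continuous (indlim_incl MN)) /\
    (exists MN : projlim_set (upper_system M) `<=` projlim_set (upper_system N),
      continuous (projlim_incl MN))).
Proof.
split; first exact: preceq_c_of_root_bound.
move=> /preceq_c_rescale[k [D NM]]; split.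
  (* The step of index [k.+1 * n.+1] has dilation one more than the product
     [k.+1 * n.+1] that [NM] asks for. *)
  apply: indlim_incl_continuous => n; exists (k.+1 * n.+1)%N, D.
  by apply: NM; rewrite /= -natrM ler_nat.
apply: projlim_incl_continuous => n; exists (k.+1 * n.+1)%N, D.
apply: NM; rewrite /= ler_pdivrMr// ler_pdivlMl// -natrM ler_nat.
by rewrite mulnC leqnSn.
Qed.
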